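(* Let $n\ge 1$, $R>0$, $0<T<\infty$, $\lambda>0$, $0<C<\infty$, and let $B_R\subset\mathbb{R}^n$ be the ball of radius $R$ centred at the origin. Suppose that the function $u(x,t)$ is in $C^{2,1}(\overline{B}_R\times[0,T))$ and satisfies $$u_t=\Delta u+\lambda e^{u},\qquad (x,t)\in B_R\times(0,T),$$ $$u(x,t)\le\log\frac{C}{T-t},\qquad (x,t)\in\overline{B}_R\times(0,T),$$ $$u(x,0)=u_0(x),\qquad x\in B_R,$$ where $$\lambda\,[4R^2(n+1)+1]\le\min\left\{\frac{1}{C},\ \frac{4(n+1)}{R^2+4(n+1)T}\,e^{-\|u_0\|_\infty}\right\}.$$ Then for any $0\le a<R$ there exists a positive constant $A$ such that $$u(x,t)\le\log\left[\frac{1}{A(R^2-r^2)^2}\right]<\infty\qquad\text{for } 0\le |x|\le a<R,\ 0<t<T,$$ where $r=|x|$.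
   Context: $C^{2,1}$ means twice continuously differentiable in $x$ and once continuously differentiable in $t$. $\|u_0\|_\infty$ denotes the supremum norm of $u_0$ on $B_R$. *)

(* Defs.v *)
From HB Require Import structures.
From mathcomp Require Import all_boot all_order all_algebra.
From mathcomp Require Import all_classical all_reals all_analysis.
Set Implicit Arguments.
Unset Strict Implicit.
Unset Printing Implicit Defensive.
Import Order.TTheory GRing.Theory Num.Theory.
Import numFieldNormedType.Exports.
Local Open Scope classical_set_scope.
Local Open Scope ring_scope.

(* The norm `|x| of the library on row vectors is the max norm, whence a
   separate Euclidean norm; both induce the same topology. *)
Definition enorm (K : realType) (n : nat) (x : 'rV[K]_n) : K :=
  Num.sqrt (\sum_(i < n) x ord0 i ^+ 2).

Definition eball (K : realType) (n : nat) (R : K) : set 'rV[K]_n :=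
  [set x | enorm x < R].

Definition partial (K : realType) (n : nat) (i : 'I_n) (f : 'rV[K]_n -> K)
    (x : 'rV[K]_n) : K :=
  'D_(delta_mx ord0 i) f x.

Definition laplacian (K : realType) (n : nat) (f : 'rV[K]_n -> K)
    (x : 'rV[K]_n) : K :=
  \sum_(i < n) partial i (partial i f) x.

Definition sup_norm (K : realType) (X : Type) (D : set X) (f : X -> K) : K :=
  sup [set `|f x| | x in D].

Definition extends_continuously (K : realType) (X : topologicalType)
    (E D : set X) (g : X -> K) : Prop :=
  exists h : X -> K, {within D, continuous h} /\ forall p, E p -> h p = g p.

(* u is of class C^{2,1} on closure Om `*` [0, T[, for Om open: u is continuous
   there, the derivatives u_t, u_{x_i} and u_{x_i x_j} exist on the interior
   Om `*` ]0, T[ and each of them extends continuously to closure Om `*` [0, T[.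
   As u is a total function, its values outside of this cylinder are junk, so
   that derivatives are taken at interior points only. *)
Definition C21_closed_cylinder (K : realType) (n : nat) (Om : set 'rV[K]_n)
    (T : K) (u : 'rV[K]_n -> K -> K) : Prop :=
  let Q := Om `*` [set` `]0, T[ ] in
  let Qbar := closure Om `*` [set` `[0, T[ ] in
  [/\ {within Qbar, continuous (fun p : 'rV[K]_n * K => u p.1 p.2)},
      (forall x t, Om x -> 0 < t < T ->
        [/\ derivable (u x) t 1,
            forall i, derivable (u ^~ t) x (delta_mx ord0 i) &
            forall i j,
              derivable (partial i (u ^~ t)) x (delta_mx ord0 j)]),
      extends_continuously Q Qbar
        (fun p : 'rV[K]_n * K => derive1 (u p.1) p.2),
      (forall i, extends_continuously Q Qbar
        (fun p : 'rV[K]_n * K => partial i (u ^~ p.2) p.1)) &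
      (forall i j, extends_continuously Q Qbar
        (fun p : 'rV[K]_n * K => partial j (partial i (u ^~ p.2)) p.1))].

(* Main.v *)
(* Write r for the Euclidean norm of x.  The function v = - ln psi with
   psi = A (R^2 - r^2)^2 + B (T - t) satisfies
   v_t > Delta v + lambda e^v as soon as B > 4 A (n+1) R^2 + lambda.
   With A = lambda / 2 and B = lambda (3 R^2 (n+1) + 1) the smallness of lambda
   makes u < v at t = 0 and, because B < 1/C and psi = B (T - t) on the
   sphere r = R, also on the lateral boundary.  If u < v failed inside,
   at a first touching point the pure second derivatives of u - v would be
   nonpositive and its time derivative nonnegative, contradicting the equation.
   Finally v <= - ln (A (R^2 - r^2)^2). *)
Require Import Defs.
From HB Require Import structures.
From mathcomp Require Import all_boot all_order all_algebra.
From mathcomp Require Import all_classical all_reals all_analysis.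
From mathcomp Require Import ring lra.
Set Implicit Arguments.
Unset Strict Implicit.
Unset Printing Implicit Defensive.
Import Order.TTheory GRing.Theory Num.Theory.
Import numFieldNormedType.Exports.
Local Open Scope classical_set_scope.
Local Open Scope ring_scope.

(** * Calculus of one variable at a maximum *)

Lemma is_derive_slope (K : realType) (f : K -> K) (c l : K) :
  is_derive c 1 f l -> h^-1 * (f (h + c) - f c) @[h --> 0^'] --> l.
Proof.
move=> [df <-]; rewrite /derive.
have : cvg (h^-1 *: ((f \o shift c) (h *: 1) - f c) @[h --> 0^']) by [].
by under eq_fun do rewrite /= [X in X + c]mulr1.
Qed.

(** Fermat gives [f' c = 0]. If [l] were positive, the difference quotients of [f'] at [c] would
    make [f'] positive just to the right of [c], and the mean value theorem would push [f] above
    [f c] there. The second derivative is taken at [c] alone, so no continuity of it enters. *)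
Lemma derive2_le0_at_max (K : realType) (f f' : K -> K) (c l : K) :
  (\forall s \near c, is_derive (s : K) (1 : K) f (f' s)) ->
  (\forall s \near c, f s <= f c) ->
  is_derive c 1 f' l -> l <= 0.
Proof.
move=> df fmax df'; rewrite leNgt; apply/negP => l0.
have sl : \forall h \near 0^', 0 < h^-1 * (f' (h + c) - f' c).
  exact: cvgr_gt (is_derive_slope df') _ l0.
have /nbhs_ballP[e1 /= e10 He1] := df.
have /nbhs_ballP[e2 /= e20 He2] := fmax.
have /nbhs_ballP[e3 /= e30 He3] := sl.
pose e := Num.min e1 (Num.min e2 e3).
have e0 : 0 < e by rewrite !lt_min e10 e20.
have ee1 : e <= e1 by rewrite ge_min lexx.
have ee2 : e <= e2 by rewrite !ge_min lexx orbT.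
have ee3 : e <= e3 by rewrite !ge_min lexx !orbT.
have inball s : `|s - c| < e -> is_derive s 1 f (f' s) /\ f s <= f c.
  move=> se; split.
    by apply: He1; rewrite /ball /= distrC (lt_le_trans se).
  by apply: He2; rewrite /ball /= distrC (lt_le_trans se).
have f'c0 : f' c = 0.
  have [||||_ <-] := @derive1_at_max K f (c - e) (c + e) c.
  - by lra.
  - move=> s; rewrite in_itv /= => /andP[s1 s2].
    by have [|[]] := inball s; first by rewrite ltr_distl s1.
  - by rewrite in_itv /=; lra.
  - move=> s; rewrite in_itv /= => /andP[s1 s2].
    by have [|[]] := inball s; first by rewrite ltr_distl s1.
  by have [|[_ ->]] := inball c; first by rewrite subrr normr0.
have cd : c < c + e / 2 by lra.
have [||s] := @MVT K f f' c (c + e / 2) cd.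
- move=> s; rewrite in_itv /= => /andP[s1 s2].
  by have [|[]] := inball s; first by rewrite ltr_distl; lra.
- apply: derivable_within_continuous => s; rewrite in_itv /= => /andP[s1 s2].
  by have [|[]] := inball s; first by rewrite ltr_distl; lra.
rewrite in_itv /= => /andP[s1 s2] fs.
have [|_] := inball (c + e / 2); first by rewrite ltr_distl; lra.
have : 0 < f' s.
  have := He3 (s - c); rewrite /ball /= sub0r normrN subrK f'c0 subr0.
  rewrite pmulr_rgt0 ?invr_gt0 ?subr_gt0//; apply.
    by rewrite ger0_norm; lra.
  by rewrite subr_eq0 gt_eqF.
by move=> f's; rewrite -subr_le0 fs pmulr_rle0 //; lra.
Qed.

(** One-sided because a first touching time gives information about earlier times only: a negative
    slope would make [f] exceed [f c] just before [c]. *)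
Lemma derive1_ge0_at_left_max (K : realType) (f : K -> K) (c l : K) :
  (\forall s \near c^'-, f s <= f c) -> is_derive c 1 f l -> 0 <= l.
Proof.
move=> fmax /is_derive_slope sl; rewrite leNgt; apply/negP => l0.
have /nbhs_ballP[e1 /= e10 He1] :
    \forall h \near 0^', h^-1 * (f (h + c) - f c) < 0.
  exact: cvgr_lt sl _ l0.
have /nbhs_ballP[e2 /= e20 He2] := fmax.
pose e := Num.min e1 e2.
have e0 : 0 < e by rewrite lt_min e10.
have ee1 : e <= e1 by rewrite ge_min lexx.
have ee2 : e <= e2 by rewrite ge_min lexx orbT.
have := He2 (c - e / 2); rewrite /ball /= opprB addrC subrK.
rewrite ger0_norm; last lra.
move=> H; have {H} := H ltac:(lra) ltac:(lra).
have := He1 (- (e / 2)); rewrite /ball /= sub0r opprK.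
rewrite ger0_norm; last lra.
move=> H; have {H} := H ltac:(lra) ltac:(lra).
rewrite [_ + c]addrC nmulr_rlt0 ?invr_lt0; lra.
Qed.

(** Both derivatives are limits of the same difference quotient. This reduces partial derivatives to
    the calculus of one variable. *)
Lemma is_derive_line (K : realType) (V : normedModType K) (f : V -> K)
    (x v : V) (s : K) :
  derivable f (s *: v + x) v ->
  is_derive s 1 (fun r : K => f (r *: v + x)) ('D_v f (s *: v + x)).
Proof.
have E : (fun h : K => h^-1 *: (((fun r => f (r *: v + x)) \o shift s) (h *: 1)
            - f (s *: v + x))) =
         (fun h => h^-1 *: ((f \o shift (s *: v + x)) (h *: v)
            - f (s *: v + x))).
  by apply/funext => h; rewrite /= [h *: 1]mulr1 scalerDl addrA.
by move=> df; split; [rewrite /derivable E | rewrite /derive E].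
Qed.

(** * Euclidean norm and balls *)

(** The square of [enorm], free of the root, so that it is a polynomial along each line. *)
Definition sqn (K : realType) (n : nat) (x : 'rV[K]_n) : K :=
  \sum_(i < n) x ord0 i ^+ 2.

Lemma sqn_ge0 (K : realType) n (x : 'rV[K]_n) : 0 <= sqn x.
Proof. by apply: sumr_ge0 => i _; exact: sqr_ge0. Qed.

Lemma enorm_sq (K : realType) n (x : 'rV[K]_n) : enorm x ^+ 2 = sqn x.
Proof. by rewrite sqr_sqrtr // sqn_ge0. Qed.

Lemma sqn_continuous (K : realType) n : continuous (@sqn K n).
Proof.
rewrite /sqn; apply: continuous_big => [|i _ x]; first exact: add_continuous.
by apply: (@continuousM K); exact: coord_continuous.
Qed.

Lemma enorm_continuous (K : realType) n : continuous (@enorm K n).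
Proof.
move=> x; apply: continuous_comp; first exact: sqn_continuous.
exact: sqrt_continuous.
Qed.

Lemma open_eball (K : realType) n (R : K) : open (@eball K n R).
Proof.
exact: (open_comp (fun x _ => @enorm_continuous K n x) (@open_lt K R)).
Qed.

Lemma closure_eball_le (K : realType) n (R : K) (x : 'rV[K]_n) :
  closure (@eball K n R) x -> enorm x <= R.
Proof.
have cl : closed [set y : 'rV[K]_n | enorm y <= R].
  exact: (closed_comp (fun x _ => @enorm_continuous K n x) (@closed_le K R)).
move=> /(closure_subset (B := [set y | enorm y <= R])).
by rewrite -(closure_id _).1 //; apply => y /ltW.
Qed.

Lemma coord_le_enorm (K : realType) n (x : 'rV[K]_n) i :
  `|x ord0 i| <= enorm x.
Proof.
rewrite -sqrtr_sqr ler_sqrt ?sqn_ge0 //.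
by rewrite (bigD1 i) //= lerDl sumr_ge0 // => j _; exact: sqr_ge0.
Qed.

(** * Compactness and the first touching time *)

Lemma compact_closure_eball (K : realType) n (R : K) :
  compact (closure (@eball K n R)).
Proof.
apply: bounded_closed_compact; last exact: closed_closure.
exists R; split; first exact: num_real.
move=> M RM x /closure_eball_le xR.
have R0 : 0 <= R by apply: le_trans xR; exact: sqrtr_ge0.
rewrite /Num.Def.normr /= mx_normrE.
apply: bigmax_le => [|[i j] _]; first lra.
rewrite [i]ord1 /=.
by rewrite (le_trans (coord_le_enorm _ _)) // (le_trans xR) // ltW.
Qed.

(** The touching point minimises time over the compact set where [g] is nonnegative. Before that
    time [g] is negative; at that time continuity in [t] gives [g <= 0]. *)
Lemma first_touching (K : realType) (X : topologicalType) (D : set X) (b : K)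
    (g : X -> K -> K) :
  compact D ->
  {within D `*` `[0, b], continuous (fun p : X * K => g p.1 p.2)} ->
  (forall x, D x -> g x 0 < 0) ->
  (exists x t, [/\ D x, 0 <= t <= b & 0 <= g x t]) ->
  exists x t, [/\ D x, 0 < t <= b, g x t = 0 &
    forall y s, D y -> 0 <= s <= t -> g y s <= 0].
Proof.
set Q := D `*` _ => cD /subspace_continuousP cg g0 [x1 [t1 [Dx1 t1b gx1]]].
have cQ : compact Q by apply: compact_setX => //; exact: segment_compact.
pose S := Q `&` [set p | 0 <= g p.1 p.2].
(* Continuity holds only within [Q], so closedness is checked on filters: around a cluster point
   with [g < 0], all nearby points of [Q] would have [g < 0] and miss [S]. *)
have cS : compact S.
  move=> F FF FS.
  have [|p [Qp clp]] := cQ F FF; first by apply: filterS FS => p [].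
  exists p; split=> //; split=> //=; rewrite leNgt; apply/negP => gp.
  have nb : nbhs p [set q | Q q -> g q.1 q.2 < 0].
    exact: (cvgr_lt _ (cg p Qp) 0 gp).
  by have [q [[Qq gq] /(_ Qq)]] := clp _ _ FS nb; rewrite ltNge gq.
have [||[x t] /set_mem[[/= Dx tb] gxt] mint] :=
    @compact_EVT_min _ K (fun p : X * K => p.2) S _ cS.
- by exists (x1, t1); split; [split=> //=; rewrite in_itv | ].
- by apply: continuous_subspaceT => p; exact: cvg_snd.
move: tb; rewrite /= in_itv /= => /andP[t0 tb].
have early y s : D y -> 0 <= s < t -> g y s < 0.
  move=> Dy /andP[s0 st]; rewrite ltNge; apply/negP => gys.
  have : S (y, s) by split=> //; split=> //=; rewrite in_itv /= s0 /=; lra.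
  by move/mem_set/mint => /=; rewrite leNgt st.
have {}t0 : 0 < t.
  rewrite lt_neqAle t0 andbT; apply/eqP => t0'.
  by move: gxt; rewrite -t0' leNgt g0.
have att y : D y -> g y t <= 0.
  move=> Dy; rewrite leNgt; apply/negP => gyt.
  have Qyt : Q (y, t) by split=> //=; rewrite in_itv /= ltW.
  have : nbhs (y, t) [set q | Q q -> 0 < g q.1 q.2].
    exact: (cvgr_gt _ (cg _ Qyt) 0 gyt).
  move=> [[A B] /= [nA /nbhs_ballP[e /= e0 Be]] AB].
  (* An earlier time that is still nonnegative and lies within [e] of [t]; positivity of [g] there
     contradicts [early]. *)
  pose s := Num.max (t / 2) (t - e / 2).
  have st : s < t by rewrite gt_max; apply/andP; split; lra.
  have s0 : t / 2 <= s by rewrite le_max lexx.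
  have se : t - e / 2 <= s by rewrite le_max lexx orbT.
  have : 0 < g y s.
    apply: (AB (y, s)).
      split=> /=; first exact: nbhs_singleton.
      by apply: Be; rewrite /ball /= ger0_norm; lra.
    by split=> //=; rewrite in_itv /=; lra.
  by rewrite ltNge ltW // early // st andbT; lra.
exists x, t; split=> //; first by rewrite t0.
  by apply/eqP; rewrite eq_le gxt att.
move=> y s Dy /andP[s0]; rewrite le_eqVlt => /predU1P[->|st]; first exact: att.
by apply/ltW/early => //; rewrite s0.
Qed.

(** * The barrier and its derivatives *)

(** The second derivative test for [f + ln p], with [(ln p)'' = p'' / p - (p' / p)^2]. A polynomial
    [p] suffices, as the barrier is one along each coordinate line, and its derivatives are then
    formal. *)
Lemma derive2_le_log_horner (K : realType) (f f' : K -> K) (p : {poly K})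
    (c l : K) :
  (\forall s \near c, is_derive (s : K) (1 : K) f (f' s)) ->
  is_derive c 1 f' l -> 0 < p.[c] ->
  (\forall s \near c, f s + ln p.[s] <= f c + ln p.[c]) ->
  l + (p^`()^`().[c] / p.[c] - (p^`().[c] / p.[c]) ^+ 2) <= 0.
Proof.
move=> df df' pc0 fmax.
have pgt0 : \forall s \near c, 0 < p.[s].
  exact: cvgr_gt (@continuous_horner _ p c) _ pc0.
apply: (@derive2_le0_at_max _ (f + (@ln K \o horner p))
  (fun s => f' s + p.[s]^-1 * p^`().[s]) c) => //.
  near=> s; apply: is_deriveD; first by near: s.
  apply: is_derive1_comp (is_derive1_ln _) (is_derive_poly p s).
  by near: s.
have dV := is_deriveV (lt0r_neq0 pc0) (is_derive_poly p c).
apply: is_derive_eq (is_deriveD df' (is_deriveM dV (is_derive_poly p^`() c))) _.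
by rewrite /GRing.scale /=; field; rewrite lt0r_neq0.
Unshelve. all: by end_near. Qed.

(** The function [psi] at a frozen time, with [c] standing for [B * (T - t)]. *)
Definition barrier (K : realType) (n : nat) (R A c : K) (x : 'rV[K]_n) : K :=
  A * (R ^+ 2 - sqn x) ^+ 2 + c.

Lemma barrier_gt0 (K : realType) n (R A c : K) (x : 'rV[K]_n) :
  0 <= A -> 0 < c -> 0 < barrier R A c x.
Proof. by move=> A0 c0; rewrite ltr_wpDl // mulr_ge0 // sqr_ge0. Qed.

Lemma sqn_line (K : realType) n (x : 'rV[K]_n) i s :
  sqn (s *: delta_mx ord0 i + x) = sqn x + 2 * x ord0 i * s + s ^+ 2.
Proof.
rewrite /sqn (bigD1 i) //= [in RHS](bigD1 i) //= !mxE !eqxx /=.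
under eq_bigr => j ji do rewrite !mxE (negbTE ji) andbF mulr0 add0r.
ring.
Qed.

Lemma partial2_le_barrier (K : realType) n (R A c : K) (O : set 'rV[K]_n)
    (w : 'rV[K]_n -> K) (x : 'rV[K]_n) (i : 'I_n) :
  open O -> O x ->
  (forall y, O y -> derivable w y (delta_mx ord0 i)) ->
  derivable (partial i w) x (delta_mx ord0 i) ->
  0 < barrier R A c x ->
  (forall y, O y -> w y + ln (barrier R A c y) <= w x + ln (barrier R A c x)) ->
  partial i (partial i w) x <=
    (4 * A * (R ^+ 2 - sqn x) * x ord0 i / barrier R A c x) ^+ 2
    - A * (8 * x ord0 i ^+ 2 - 4 * (R ^+ 2 - sqn x)) / barrier R A c x.
Proof.
move=> oO Ox dw dpw psi0 wmax.
pose e : 'rV[K]_n := delta_mx ord0 i.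
(* The barrier on the line [s *: e + x], a quartic in [s] by [sqn_line]. *)
pose p : {poly K} :=
  A *: ((R ^+ 2 - sqn x)%:P - (2 * x ord0 i) *: 'X - 'X ^+ 2) ^+ 2 + c%:P.
have pE s : p.[s] = barrier R A c (s *: e + x).
  rewrite /barrier sqn_line /p !hornerE /=; ring.
have p0 : p.[0] = barrier R A c x by rewrite pE scale0r add0r.
have dp0 : p^`().[0] = - (4 * A * (R ^+ 2 - sqn x) * x ord0 i).
  by rewrite /p !poly.derivE !hornerE /=; ring.
have ddp0 : p^`()^`().[0] = A * (8 * x ord0 i ^+ 2 - 4 * (R ^+ 2 - sqn x)).
  by rewrite /p !poly.derivE !hornerE /=; ring.
have line0 : (0 : K) *: e + x = x by rewrite scale0r add0r.
have line_O : \forall s \near (0 : K), O (s *: e + x).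
  have : (fun s : K => s *: e + x) @ (0 : K) --> 0 *: e + x.
    apply: cvgD; last exact: cvg_cst.
    exact: scalel_continuous.
  apply; rewrite scale0r add0r; exact: open_nbhs_nbhs.
have := @derive2_le_log_horner K (fun s => w (s *: e + x))
  (fun s => partial i w (s *: e + x)) p 0 (partial i (partial i w) x).
rewrite p0 dp0 ddp0 => H.
rewrite -subr_le0; apply: le_trans (H _ _ _ _).
- rewrite le_eqVlt; apply/orP; left; apply/eqP; field; exact: lt0r_neq0.
- near=> s; apply: is_derive_line; apply: dw; near: s; exact: line_O.
- rewrite [X in is_derive _ _ _ X](_ : _ = 'D_e (partial i w) (0 *: e + x)).
    by apply: is_derive_line; rewrite line0.
  by rewrite line0.
- exact: psi0.
- near=> s; rewrite pE scale0r add0r; apply: wmax; near: s; exact: line_O.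
Unshelve. all: by end_near. Qed.

(** The arithmetic of the contradiction at a touching point: [S] is [|x|^2], [P] the value of [psi],
    [L] the Laplacian of [u] and [Ut] its time derivative. Since [A (R^2 - S)^2 <= P], the gradient
    term is at most [16 A S / P]; multiplying by [P] leaves
    [B <= A (8 S + 4 N (R^2 - S)) + lambda]. *)
Lemma barrier_supersolution (K : realType) (N R A B lambda S P L Ut : K) :
  1 <= N -> 0 < A -> 0 <= S -> S < R ^+ 2 ->
  4 * A * (N + 1) * R ^+ 2 + lambda < B ->
  0 < P -> A * (R ^+ 2 - S) ^+ 2 <= P ->
  L <= (4 * A * (R ^+ 2 - S) / P) ^+ 2 * S
       - A * (8 * S - 4 * N * (R ^+ 2 - S)) / P ->
  B / P <= Ut -> Ut = L + lambda / P -> False.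
Proof.
move=> N1 A0 S0 SR hB P0 hP hL hUt E.
have h1 : (4 * A * (R ^+ 2 - S) / P) ^+ 2 * S <= 16 * A * S / P.
  have -> : (4 * A * (R ^+ 2 - S) / P) ^+ 2 * S =
     16 * A * S / P * (A * (R ^+ 2 - S) ^+ 2 / P) by field; exact: lt0r_neq0.
  rewrite ler_piMr ?ler_pdivrMr ?mul1r // divr_ge0 ?(ltW P0) //.
  by rewrite !mulr_ge0 // ltW.
have : B / P <= (A * (8 * S + 4 * N * (R ^+ 2 - S)) + lambda) / P.
  have -> : (A * (8 * S + 4 * N * (R ^+ 2 - S)) + lambda) / P =
     16 * A * S / P - A * (8 * S - 4 * N * (R ^+ 2 - S)) / P + lambda / P.
    by field; exact: lt0r_neq0.
  lra.
rewrite ler_pM2r ?invr_gt0 // leNgt => /negP; apply; apply: le_lt_trans hB.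
have -> : 4 * A * (N + 1) * R ^+ 2 = A * (4 * (N + 1) * R ^+ 2) by ring.
rewrite lerD2r ler_pM2l //.
(* What remains is [(8 - 4 N) S <= 4 R^2], which follows from [N >= 1] and [S < R^2]. *)
have : 0 <= (N - 1) * S by rewrite mulr_ge0 // subr_ge0.
lra.
Qed.

Lemma sqn_eball (K : realType) n (R : K) (x : 'rV[K]_n) :
  0 < R -> eball R x -> sqn x < R ^+ 2.
Proof.
by move=> R0 xR; rewrite -enorm_sq ltr_pXn2r ?nnegrE ?sqrtr_ge0 // ltW.
Qed.

Lemma continuous_ln_barrier (K : realType) n (R A B T : K)
    (p : 'rV[K]_n * K) :
  0 < barrier R A (B * (T - p.2)) p.1 ->
  {for p, continuous (fun q : 'rV[K]_n * K =>
     ln (barrier R A (B * (T - q.2)) q.1))}.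
Proof.
move=> p0; apply: continuous_comp; last exact: continuous_ln.
rewrite /barrier.
have c1 : (fun q : 'rV[K]_n * K => sqn q.1) @ p --> sqn p.1.
  by apply: continuous_comp; [exact: cvg_fst|exact: sqn_continuous].
apply: cvgD; apply: cvgM; try exact: cvg_cst.
- by apply: cvgM; apply: cvgB => //; exact: cvg_cst.
- by apply: cvgB; [exact: cvg_cst|exact: cvg_snd].
Qed.

(** * Comparison with the barrier *)

(** The lower bound on [B] is strict, so touching is itself contradictory and no perturbation by a
    small parameter enters. *)
Lemma lt_barrier (K : realType) (n : nat) (R T lambda A B : K)
    (u : 'rV[K]_n -> K -> K) :
  (1 <= n)%N -> 0 < R -> 0 < A -> 0 < B ->
  4 * A * (n%:R + 1) * R ^+ 2 + lambda < B ->
  C21_closed_cylinder (@eball K n R) T u ->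
  (forall x t, eball R x -> 0 < t < T ->
     derive1 (u x) t = laplacian (u ^~ t) x + lambda * expR (u x t)) ->
  (forall x, closure (@eball K n R) x ->
     u x 0 + ln (barrier R A (B * (T - 0)) x) < 0) ->
  (forall x t, closure (@eball K n R) x -> R <= enorm x -> 0 < t < T ->
     u x t + ln (barrier R A (B * (T - t)) x) < 0) ->
  forall x t, eball R x -> 0 <= t < T ->
     u x t + ln (barrier R A (B * (T - t)) x) < 0.
Proof.
move=> hn R0 A0 B0 hB [uc ud _ _ _] heq hini hbd x1 t1 x1R /andP[t10 t1T].
rewrite ltNge; apply/negP => gx1.
have bar0 x t : t < T -> 0 < barrier R A (B * (T - t)) x.
  by move=> tT; rewrite barrier_gt0 ?(ltW A0) // mulr_gt0 // subr_gt0.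
pose g x t := u x t + ln (barrier R A (B * (T - t)) x).
have [||x [t [Dx /andP[t0 tt1] gxt gle]]] :=
  @first_touching K _ (closure (@eball K n R)) t1 g
    (@compact_closure_eball K n R) _ hini.
- have sub : closure (@eball K n R) `*` `[0, t1] `<=`
      closure (@eball K n R) `*` [set` `[0, T[ ].
    move=> [x t] [/= Dx]; rewrite !in_itv /= => /andP[-> tt1]; split=> //=.
    exact: le_lt_trans t1T.
  apply/subspace_continuousP => p Qp; apply: cvgD.
    by move/subspace_continuousP : (continuous_subspaceW sub uc); apply.
  apply: cvg_within_filter; apply: continuous_ln_barrier; apply: bar0.
  by move: Qp => [_ /=]; rewrite in_itv /= => /andP[_ /le_lt_trans]; apply.
- by exists x1, t1; split; [exact: subset_closure|rewrite t10 lexx|].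
have tT : t < T by exact: le_lt_trans t1T.
have t0T : 0 < t < T by rewrite t0.
have xR : eball R x.
  rewrite /eball /= ltNge; apply/negP => Rx.
  by have := hbd x t Dx Rx t0T; rewrite -/(g x t) gxt ltxx.
have [dut dux dux2] := ud x t xR t0T.
set P := barrier R A (B * (T - t)) x.
have P0 : 0 < P by exact: bar0.
(* Touching means [u = - ln P], which turns the reaction term into [lambda / P]. *)
have euP : expR (u x t) = P^-1.
  have -> : u x t = - ln P by move: gxt; rewrite /g -/P; lra.
  by rewrite expRN lnK.
have SR := sqn_eball R0 xR.
apply: (@barrier_supersolution K n%:R R A B lambda (sqn x) P
  (laplacian (u ^~ t) x) (derive1 (u x) t)) => //.
- by rewrite ler1n.
- exact: sqn_ge0.
- by rewrite /P /barrier lerDl mulr_ge0 ?subr_ge0 ?(ltW B0) ?(ltW tT).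
(* The bound on the Laplacian is split into one bound for each pure second derivative. *)
- have -> : (4 * A * (R ^+ 2 - sqn x) / P) ^+ 2 * sqn x -
      A * (8 * sqn x - 4 * n%:R * (R ^+ 2 - sqn x)) / P =
    \sum_(i < n) ((4 * A * (R ^+ 2 - sqn x) * x ord0 i / P) ^+ 2
      - A * (8 * x ord0 i ^+ 2 - 4 * (R ^+ 2 - sqn x)) / P).
    transitivity (\sum_(i < n) (
      ((4 * A * (R ^+ 2 - sqn x) / P) ^+ 2 - 8 * A / P) * x ord0 i ^+ 2
      + 4 * A * (R ^+ 2 - sqn x) / P)).
      rewrite big_split /= -mulr_sumr -/(sqn x) sumr_const card_ord -mulr_natr.
      by field; exact: lt0r_neq0.
    by apply: eq_bigr => i _; field; exact: lt0r_neq0.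
  apply: ler_sum => i _.
  apply: (@partial2_le_barrier K n R A (B * (T - t)) (eball R) (u ^~ t) x i).
  + exact: open_eball.
  + exact: xR.
  + by move=> y yR; have [_ + _] := ud y t yR t0T; apply.
  + exact: dux2.
  + exact: P0.
  + move=> y yR; rewrite -[leRHS]/(g x t) gxt.
    by apply: gle; [exact: subset_closure|rewrite (ltW t0) lexx].
(* In time the barrier is affine with slope [- B], so the left maximum at [t] yields
   [0 <= u_t - B / P]. *)
- pose p : {poly K} := (P + B * t)%:P - B *: 'X.
  have pE s : p.[s] = barrier R A (B * (T - s)) x.
    by rewrite /p /P /barrier !hornerE /=; ring.
  have pt : p.[t] = P by rewrite pE.
  have dlog : is_derive t 1 (@ln K \o horner p) (p.[t]^-1 * p^`().[t]).
    apply: is_derive1_comp (is_derive1_ln _) (is_derive_poly p t).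
    by rewrite pt.
  have dg : is_derive t 1 (u x + (@ln K \o horner p))
      ('D_1 (u x) t + p.[t]^-1 * p^`().[t]).
    exact: is_deriveD (derivableP dut) dlog.
  have := derive1_ge0_at_left_max _ dg.
  rewrite pt /p !poly.derivE !hornerE /= derive1E.
  suff le : \forall s \near t^'-,
      (u x + (@ln K \o horner p)) s <= (u x + (@ln K \o horner p)) t.
    by move=> /(_ le); lra.
  near=> s; rewrite /GRing.add /= pt pE -/P.
  rewrite -[leRHS]/(g x t) gxt; apply: gle => //; apply/andP; split.
    by near: s; exact: nbhs_left_ge.
  by near: s; exact: nbhs_left_le.
- by rewrite (heq _ _ xR t0T) euP.
Unshelve. all: by end_near. Qed.

(** * Bounds on the initial data *)

(** The initial condition is prescribed on the open ball only; continuity of [u] carries a bound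
    over to the sphere. *)
Lemma closure_initial_le (K : realType) (n : nat) (R T M : K)
    (u : 'rV[K]_n -> K -> K) :
  0 < T -> C21_closed_cylinder (@eball K n R) T u ->
  (forall x, eball R x -> u x 0 <= M) ->
  forall x, closure (@eball K n R) x -> u x 0 <= M.
Proof.
move=> T0 [/subspace_continuousP uc _ _ _ _] uM x Dx.
rewrite leNgt; apply/negP => ux.
have in0 y : closure (eball R) y ->
    (closure (@eball K n R) `*` [set` `[0, T[ ]) (y, 0).
  by move=> Dy; split=> //=; rewrite in_itv /= lexx.
have : nbhs (x, 0) [set q | (closure (@eball K n R) `*` [set` `[0, T[ ]) q ->
    M < u q.1 q.2].
  exact: (cvgr_gt _ (uc _ (in0 _ Dx)) M ux).
move=> [[U V] /= [nU nV] UV].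
have [y [yR Uy]] := Dx _ nU.
have := UV (y, 0) (conj Uy (nbhs_singleton nV)) (in0 _ (subset_closure yR)).
by rewrite /= ltNge uM.
Qed.

(** A real [sup] bounds its set only if the set is bounded above. Here boundedness of [u0] comes
    from continuity of [u] on the compact bottom of the cylinder. *)
Lemma initial_le_sup_norm (K : realType) (n : nat) (R T : K)
    (u : 'rV[K]_n -> K -> K) (u0 : 'rV[K]_n -> K) :
  0 < T -> C21_closed_cylinder (@eball K n R) T u ->
  (forall x, eball R x -> u x 0 = u0 x) ->
  forall x, eball R x -> u x 0 <= sup_norm (@eball K n R) u0.
Proof.
move=> T0 [uc _ _ _ _] hinit x xR.
have sub : closure (@eball K n R) `*` [set 0] `<=`
    closure (@eball K n R) `*` [set` `[0, T[ ].
  by move=> [y t] [/= Dy ->]; split=> //=; rewrite in_itv /= lexx.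
have cQ : compact (closure (@eball K n R) `*` [set (0 : K)]).
  by apply: compact_setX; [exact: compact_closure_eball|exact: compact_set1].
have [M [_ hM]] :=
  compact_bounded (continuous_compact (continuous_subspaceW sub uc) cQ).
apply: le_trans (ler_norm _) _; rewrite hinit //.
apply: ub_le_sup; last by exists x.
exists (M + 1) => _ [y yR <-]; rewrite -hinit //.
apply: (hM (M + 1)); first by rewrite ltrDl.
by exists (y, 0) => //; split=> //=; exact: subset_closure.
Qed.

(** * Choice of constants and conclusion *)

Lemma add_ln_lt0 (K : realType) (v P : K) :
  0 < P -> P < expR (- v) -> v + ln P < 0.
Proof.
by move=> P0; rewrite -[X in X < _]lnK // ltr_expR => ?; lra.
Qed.

Theorem theorem4p1 (K : realType) (n : nat) (R T lambda C : K)
    (u : 'rV[K]_n -> K -> K) (u0 : 'rV[K]_n -> K)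
    (hn : (1 <= n)%N) (hR : 0 < R) (hT : 0 < T) (hlambda : 0 < lambda)
    (hC : 0 < C)
    (hu : C21_closed_cylinder (@eball K n R) T u)
    (heq : forall x t, eball R x -> 0 < t < T ->
       derive1 (u x) t = laplacian (u ^~ t) x + lambda * expR (u x t))
    (hbound : forall x t, closure (@eball K n R) x -> 0 < t < T ->
       u x t <= ln (C / (T - t)))
    (hinit : forall x, eball R x -> u x 0 = u0 x)
    (hsmall : lambda * (4 * R ^+ 2 * (n%:R + 1) + 1) <=
       Num.min (1 / C)
         (4 * (n%:R + 1) / (R ^+ 2 + 4 * (n%:R + 1) * T)
            * expR (- sup_norm (@eball K n R) u0))) :
  forall a : K, 0 <= a < R ->
    exists2 A : K, 0 < A &
      forall x t, enorm x <= a -> 0 < t < T ->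
        ((u x t)%:E <=
           lne (1 / (A * (R ^+ 2 - enorm x ^+ 2) ^+ 2)%:E) < +oo)%E.
Proof.
move=> a /andP[a0 aR].
have A0 : 0 < lambda / 2 by rewrite divr_gt0.
exists (lambda / 2) => // x t xa /andP[t0 tT].
move: hsmall; rewrite le_min => /andP[hsC hsM].
set N : K := n%:R in hsC hsM *.
have N1 : 1 <= N by rewrite ler1n.
have R2 : 0 < R ^+ 2 by rewrite exprn_gt0.
have NR : 0 < (N + 1) * R ^+ 2 by rewrite mulr_gt0 //; lra.
(* The factor 3 lies strictly between the 2 that the supersolution inequality requires for
   [A = lambda / 2] and the 4 in the smallness hypothesis. *)
pose B := lambda * (3 * R ^+ 2 * (N + 1) + 1).
have B0 : 0 < B by rewrite mulr_gt0 //; lra.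
have BD : B < lambda * (4 * R ^+ 2 * (N + 1) + 1) by rewrite ltr_pM2l //; lra.
have hB : 4 * (lambda / 2) * (N + 1) * R ^+ 2 + lambda < B.
  have -> : 4 * (lambda / 2) * (N + 1) * R ^+ 2 + lambda =
    lambda * (2 * R ^+ 2 * (N + 1) + 1) by field.
  by rewrite ltr_pM2l //; lra.
have BC : B < C^-1 by rewrite -div1r; exact: lt_le_trans hsC.
have bar0 s (y : 'rV[K]_n) :
    s < T -> 0 < barrier R (lambda / 2) (B * (T - s)) y.
  by move=> sT; rewrite barrier_gt0 ?(ltW A0) // mulr_gt0 // subr_gt0.
have xR : eball R x by exact: le_lt_trans aR.
have sqR : forall y, closure (@eball K n R) y -> sqn y <= R ^+ 2.
  move=> y /closure_eball_le yR.
  by rewrite -enorm_sq ler_pXn2r // nnegrE ?sqrtr_ge0 // ltW.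
have hini (y : 'rV[K]_n) : closure (@eball K n R) y ->
    u y 0 + ln (barrier R (lambda / 2) (B * (T - 0)) y) < 0.
  move=> Dy; apply: add_ln_lt0; first exact: bar0.
  have : expR (- sup_norm (@eball K n R) u0) <= expR (- u y 0).
    rewrite ler_expR lerN2.
    apply: (closure_initial_le hT hu _ Dy) => z.
    exact: (initial_le_sup_norm hT hu hinit).
  apply: lt_le_trans; rewrite subr0.
  set E := expR _ in hsM *.
  have k0 : 0 < 4 * (N + 1) by lra.
  have kT : 0 < R ^+ 2 + 4 * (N + 1) * T by rewrite ltr_wpDr // mulr_ge0 // ltW.
  have : lambda * (4 * R ^+ 2 * (N + 1) + 1) * (R ^+ 2 + 4 * (N + 1) * T)
      <= 4 * (N + 1) * E.
    by rewrite -ler_pdivlMr // [leRHS]mulrAC.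
  move=> hE; rewrite -(ltr_pM2l k0); apply: lt_le_trans hE.
  have s0 := sqn_ge0 y; have s1 := sqR y Dy.
  (* At time 0 the barrier is largest at the centre of the ball. *)
  have hb : barrier R (lambda / 2) (B * T) y <=
      lambda / 2 * (R ^+ 2) ^+ 2 + B * T.
    rewrite /barrier lerD2r ler_pM2l // ler_pXn2r ?nnegrE //; lra.
  apply: (@le_lt_trans _ _
    (4 * (N + 1) * (lambda / 2 * (R ^+ 2) ^+ 2 + B * T))).
    by rewrite ler_pM2l.
  rewrite -subr_gt0 /B.
  (* The slack of the smallness hypothesis after clearing denominators: every remaining term is
     positive. *)
  have -> : lambda * (4 * R ^+ 2 * (N + 1) + 1) * (R ^+ 2 + 4 * (N + 1) * T)
     - 4 * (N + 1) * (lambda / 2 * (R ^+ 2) ^+ 2 +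
          lambda * (3 * R ^+ 2 * (N + 1) + 1) * T) =
     lambda * (2 * ((N + 1) * R ^+ 2) * R ^+ 2 + R ^+ 2
       + 4 * (N + 1) * ((N + 1) * R ^+ 2) * T) by field.
  have p1 : 0 < (N + 1) * R ^+ 2 * R ^+ 2 by rewrite mulr_gt0.
  have p2 : 0 < 4 * (N + 1) * ((N + 1) * R ^+ 2) * T.
    by rewrite !mulr_gt0 //; lra.
  by rewrite mulr_gt0 //; lra.
have hbd (y : 'rV[K]_n) s :
    closure (@eball K n R) y -> R <= enorm y -> 0 < s < T ->
    u y s + ln (barrier R (lambda / 2) (B * (T - s)) y) < 0.
  move=> Dy Ry s0T; have /andP[s0 sT] := s0T.
  apply: add_ln_lt0; first exact: bar0.
  have sT0 : 0 < T - s by rewrite subr_gt0.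
  (* On the sphere the quartic term vanishes, and [B < 1 / C] meets the assumed blow-up rate
     [exp (- u) >= (T - s) / C]. *)
  have -> : barrier R (lambda / 2) (B * (T - s)) y = B * (T - s).
    rewrite /barrier (_ : sqn y = R ^+ 2); last first.
      by rewrite -enorm_sq; congr (_ ^+ 2); apply/eqP; rewrite eq_le Ry
        closure_eball_le.
    by rewrite subrr expr0n mulr0 add0r.
  apply: (@lt_le_trans _ _ (C^-1 * (T - s))); first by rewrite ltr_pM2r.
  rewrite -[leLHS]lnK ?posrE ?mulr_gt0 ?invr_gt0 // ler_expR lerNr.
  apply: le_trans (hbound y s Dy s0T) _.
  by rewrite -lnV ?posrE ?mulr_gt0 ?invr_gt0 // invfM invrK.
have := lt_barrier hn hR A0 B0 hB hu heq hini hbd xR.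
move=> /(_ t); rewrite tT (ltW t0) => /(_ isT) ux.
have := sqn_eball hR xR; rewrite -subr_gt0 => rho0.
have Q0 : 0 < lambda / 2 * (R ^+ 2 - sqn x) ^+ 2 by rewrite mulr_gt0 ?exprn_gt0.
(* Because [|x| <= a < R], the denominator is a positive real, so the extended reciprocal and [lne]
   are finite and the claim becomes one about reals. *)
rewrite enorm_sq div1e inver gt_eqF // lne_EFin ?invr_gt0 // ltry andbT lee_fin.
rewrite lnV ?posrE //.
(* Dropping the nonnegative term [B * (T - t)] only lowers the logarithm. *)
have : ln (lambda / 2 * (R ^+ 2 - sqn x) ^+ 2) <=
    ln (barrier R (lambda / 2) (B * (T - t)) x).
  rewrite ler_ln ?posrE ?bar0 // /barrier lerDl mulr_ge0 ?(ltW B0) //.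
  by rewrite subr_ge0 ltW.
lra.
Qed.
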